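(* Let $\epsilon \in (0,1)$ and $s, k, T \in \mathbb{N}$. Let $\mathcal{W}$ be any distribution on $\{0,1\}^T$ satisfying the $\epsilon$-martingale condition, and let $\mathcal{B}_\epsilon$ be the distribution on $\{0,1\}^T$ of independent bits each equal to $1$ with probability $(1-\epsilon)/2$. Then \[ \mathbf{S}^{s,k}[\mathcal{W}] \le \mathbf{S}^{s,k}[\mathcal{B}_\epsilon] \le \exp\bigl(-\Omega(\epsilon^3(1-O(\epsilon))k)\bigr), \] where the asymptotic notation hides constants that do not depend on $\epsilon$ or $k$.
   Context: Characteristic strings and forks. A characteristic string is $w=w_1\dots w_n\in\{0,1\}^n$; index $i$ is honest if $w_i=0$ and adversarial if $w_i=1$. A fork for $w$ is a rooted tree $F=(V,E)$ with edges directed away from the root $r$, together with a labeling $\ell:V\to\{0,1,\dots,n\}$, such that (F1) $\ell(r)=0$; (F2) labels strictly increase along every directed path; (F3) every honest index $i$ is the label of exactly one vertex; (F4) if $i<j$ are honest indices then the vertex labeled $i$ has strictly smaller depth than the vertex labeled $j$. Write $F\vdash w$. A tine is a directed path starting at the root (not necessarily ending at a leaf); its length is its number of edges. For strings $x$ a prefix of $w$ and forks $F\vdash x$, $F'\vdash w$, write $F\sqsubseteq F'$ if $F$ is a subgraph of $F'$ with identical labels. Settlement. For $w\in\{0,1\}^n$ and a fork $F\vdash w_1\dots w_t$ with $s+k\le t\le n$, slot $s$ is not $k$-settled in $F$ if $F$ contains two tines of maximum length which either contain different vertices labeled $s$, or one contains a vertex labeled $s$ and the other does not; otherwise slot $s$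 is $k$-settled in $F$. Settlement game. For a distribution $\mathcal{D}$ on $\{0,1\}^T$, the $(\mathcal{D},T;s,k)$-settlement game between an adversary $\mathcal{A}$ and a deterministic challenger: (1) $w\in\{0,1\}^T$ is drawn from $\mathcal{D}$ and given to $\mathcal{A}$; (2) $A_0$ is the fork for the empty string consisting of a single root vertex; (3) for $t=1,\dots,T$ in order: (a) if $w_t=0$, the challenger forms $F_t\vdash w_1\dots w_t$ by adding one vertex labeled $t$ to the end of a longest path of $A_{t-1}$ (ties broken by $\mathcal{A}$); (b) if $w_t=1$, $\mathcal{A}$ chooses an arbitrary fork $F_t\vdash w_1\dots w_t$ with $A_{t-1}\sqsubseteq F_t$; (c) $\mathcal{A}$ chooses an arbitrary fork $A_t\vdash w_1\dots w_t$ with $F_t\sqsubseteq A_t$. $\mathcal{A}$ wins if slot $s$ is not $k$-settled in some $A_t$ with $t\ge s+k$. The $(s,k)$-settlement insecurity is $\mathbf{S}^{s,k}[\mathcal{D}]=\max_{\mathcal{A}}\Pr[\mathcal{A}\text{ wins}]$. A random variable $W=(W_1,\dots,W_n)\in\{0,1\}^n$ (or its distribution) satisfies the $\epsilon$-martingale condition if for every $t$, $\Pr[W_t=1\mid W_1,\dots,W_{t-1}]\le(1-\epsilon)/2$ (for arbitrary conditioning values). *)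

(* Defs.v *)
From HB Require Import structures.
From mathcomp Require Import all_boot all_order all_algebra.
From mathcomp Require Import boolp classical_sets reals.
From mathcomp Require Import sequences.
Set Implicit Arguments. Unset Strict Implicit. Unset Printing Implicit Defensive.
Import Order.TTheory GRing.Theory Num.Theory.
Local Open Scope ring_scope.

(* Characteristic strings are [seq bool]; [true] = 1 = adversarial,
   [false] = 0 = honest. Index i (1-based) is [nth false w i.-1]. *)

(* A fork: a rooted tree on the vertex set [fV] (vertex ids are nats),
   root [froot], the edges are (fpar v, v) for v in fV, v <> root,
   and labels [flab].  Values of fpar/flab outside fV are irrelevant. *)
Record fork := Fork { fV : seq nat; froot : nat; fpar : nat -> nat; flab : nat -> nat }.

Definition edge (F : fork) (x y : nat) : bool :=
  [&& y \in fV F, y != froot F & fpar F y == x].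

Definition tine (F : fork) (p : seq nat) : Prop :=
  exists q, p = froot F :: q /\ path (edge F) (froot F) q.

Definition tine_len (p : seq nat) : nat := (size p).-1.

Definition max_tine (F : fork) (p : seq nat) : Prop :=
  tine F p /\ forall p', tine F p' -> (tine_len p' <= tine_len p)%N.

Definition is_fork (w : seq bool) (F : fork) : Prop :=
  let n := size w in
  [/\ froot F \in fV F /\ (* F1 *) flab F (froot F) = 0%N,
      (forall v, v \in fV F -> v != froot F ->
          fpar F v \in fV F /\ (flab F (fpar F v) < flab F v)%N),
      (forall v, v \in fV F -> (flab F v <= n)%N),
      (forall i, (1 <= i <= n)%N -> ~~ nth false w i.-1 ->
          (exists v, v \in fV F /\ flab F v = i) /\
          (forall u v, u \in fV F -> v \in fV F -> flab F u = i -> flab F v = i -> u = v))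
    &
      (forall i j, (1 <= i)%N -> (i < j)%N -> (j <= n)%N ->
          ~~ nth false w i.-1 -> ~~ nth false w j.-1 ->
          forall p p', tine F p -> tine F p' ->
          flab F (last 0%N p) = i -> flab F (last 0%N p') = j ->
          (tine_len p < tine_len p')%N)].

Definition subfork (F G : fork) : Prop :=
  [/\ forall v, v \in fV F -> v \in fV G,
      froot F = froot G,
      forall v, v \in fV F -> flab F v = flab G v
    & forall v, v \in fV F -> v != froot F -> fpar F v = fpar G v].

(* slot s is NOT k-settled in F (the k only restricts t >= s+k, see game) *)
Definition unsettled (s : nat) (F : fork) : Prop :=
  exists p1 p2, max_tine F p1 /\ max_tine F p2 /\
    exists x1, x1 \in p1 /\ flab F x1 = s /\
      ((exists x2, x2 \in p2 /\ flab F x2 = s /\ x1 <> x2) \/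
       (forall x2, x2 \in p2 -> flab F x2 <> s)).

Definition root_fork : fork := Fork [:: 0%N] 0%N (fun _ => 0%N) (fun _ => 0%N).

Definition fresh (F : fork) : nat := (\max_(x <- fV F) x).+1.

Definition extend (F : fork) (v t : nat) : fork :=
  Fork (fresh F :: fV F) (froot F)
       (fun x => if x == fresh F then v else fpar F x)
       (fun x => if x == fresh F then t else flab F x).

(* A deterministic adversary; it knows the whole string w from the start.
   tieb w t A_{t-1}  : endpoint of the longest path to extend (honest t)
   advf w t A_{t-1}  : the fork F_t (adversarial t)
   augf w t F_t      : the fork A_t *)
Record adversary := Adversary {
  tieb : seq bool -> nat -> fork -> nat;
  advf : seq bool -> nat -> fork -> fork;
  augf : seq bool -> nat -> fork -> fork }.

Definition Fstep (A : adversary) (w : seq bool) (t : nat) (Ap : fork) : fork :=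
  if nth false w t.-1 then advf A w t Ap else extend Ap (tieb A w t Ap) t.

Fixpoint play (A : adversary) (w : seq bool) (t : nat) : fork :=
  match t with
  | 0 => root_fork
  | t'.+1 => augf A w t'.+1 (Fstep A w t'.+1 (play A w t'))
  end.

Definition legal (A : adversary) (w : seq bool) (T : nat) : Prop :=
  forall t, (1 <= t <= T)%N ->
    let Ap := play A w t.-1 in
    let F := Fstep A w t Ap in
    (if nth false w t.-1 then is_fork (take t w) F /\ subfork Ap F
     else exists p, max_tine Ap p /\ last 0%N p = tieb A w t Ap)
    /\ is_fork (take t w) (play A w t) /\ subfork F (play A w t).

Definition wins (A : adversary) (s k T : nat) (w : seq bool) : Prop :=
  legal A w T /\ exists t, (s + k <= t <= T)%N /\ unsettled s (play A w t).

Section Prob.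
Variable R : realType.

Definition is_distr (T : nat) (D : T.-tuple bool -> R) : Prop :=
  (forall w, 0 <= D w) /\ \sum_(w : T.-tuple bool) D w = 1.

Definition win_prob (T : nat) (D : T.-tuple bool -> R) (A : adversary) (s k : nat) : R :=
  \sum_(w : T.-tuple bool) D w * (if `[< wins A s k T w >] then 1 else 0).

Definition settle_insec (s k T : nat) (D : T.-tuple bool -> R) : R :=
  sup [set x | exists A : adversary, x = win_prob D A s k].

(* eps-martingale condition, conditional probabilities written
   multiplicatively: Pr[W_{t+1}=1 /\ prefix = b] <= (1-eps)/2 Pr[prefix = b] *)
Definition martingale_cond (eps : R) (T : nat) (D : T.-tuple bool -> R) : Prop :=
  forall t : nat, (t < T)%N -> forall b : seq bool, size b = t ->
    \sum_(w : T.-tuple bool | (take t w == b) && nth false w t) D w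
      <= (1 - eps) / 2 * \sum_(w : T.-tuple bool | take t w == b) D w.

Definition bern (eps : R) (T : nat) : T.-tuple bool -> R :=
  fun w => \prod_(i < T) (if tnth w i then (1 - eps) / 2 else 1 - (1 - eps) / 2).

End Prob.

(* Main.v *)
Require Import Defs.
From HB Require Import structures.
From mathcomp Require Import all_boot all_order all_algebra.
From mathcomp Require Import zify ring lra.
From mathcomp Require Import boolp classical_sets reals.
From mathcomp Require Import sequences exp.
Import Order.TTheory GRing.Theory Num.Theory.
Set Implicit Arguments. Unset Strict Implicit. Unset Printing Implicit Defensive.

(* Read a characteristic string as a walk S, up on adversarial and down on
   honest slots, and call a slot c Catalan if S reaches a strict record minimum
   at c and never exceeds S_c afterwards. Along a tine that avoids the vertex
   labelled c, depth(u) + A(c) < depth(c) + A(label u), where A(i) counts the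
   adversarial slots up to i; hence such a tine is never of maximum length, all
   maximum tines share their prefix up to c, and every slot s <= c is settled.

   An adversary that knows the whole string wins with the probability that the
   string is winnable. Winnable strings form an up-set, so the martingale
   distribution is dominated by the Bernoulli one.

   For independent bits, an exponential supermartingale in (reach, best
   candidate for a Catalan slot) bounds the probability that the window
   (s, s + k] has no Catalan slot by A (1 - eps^3/64)^k, with A depending only
   on s and eps. The prefactor A disappears by a tensor-power trick: having no
   Catalan slot in a window is an increasing event, so by Harris' inequality
   P(no slot in k)^n <= P(no slot in n k) <= A (1 - eps^3/64)^(n k). *)

(* [fingraph] also defines a notation [froot]. *)
Local Notation froot := Defs.froot.

(** * Adversarial counts and Catalan slots *)

Definition adv (w : seq bool) (i : nat) : nat := count id (take i w).

Lemma adv0 w : adv w 0 = 0.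
Proof. by rewrite /adv take0. Qed.

Lemma advS w i : adv w i.+1 = adv w i + nth false w i.
Proof.
rewrite /adv; case: (ltnP i (size w)) => iw.
  by rewrite (take_nth false iw) -cats1 count_cat /= addn0.
by rewrite nth_default // !take_oversize ?addn0 // ltnW.
Qed.

Lemma adv_homo w : {homo adv w : i j / i <= j}.
Proof. by apply: homo_leq => // [?|*]; [exact: leq_trans|rewrite advS leq_addr]. Qed.

Lemma adv_take w t i : i <= t -> adv (take t w) i = adv w i.
Proof. by move=> it; rewrite /adv take_takel. Qed.

(* With the walk S_i = 2 adv w i - i, slot c is Catalan if S_c is a strict
   record minimum and S never exceeds S_c afterwards. *)
Definition catalan (w : seq bool) (c : nat) : Prop :=
  [/\ 0 < c <= size w,
      forall i, i < c -> 2 * adv w c + i < 2 * adv w i + c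
    & forall j, c <= j <= size w -> 2 * adv w j + c <= 2 * adv w c + j].

Lemma catalan_honest w c : catalan w c -> ~~ nth false w c.-1.
Proof.
case=> /andP[c0 _] cL _; case: c c0 cL => // c _ /(_ c (ltnSn c)).
by rewrite advS /=; case: (nth false w c) => //=; lia.
Qed.

Lemma catalan_take w t c : c <= t -> catalan w c -> catalan (take t w) c.
Proof.
move=> ct [/andP[c0 cw] cL cR]; split.
- by rewrite c0 size_take_min leq_min ct cw.
- by move=> i ic; rewrite !adv_take //; [exact: cL|lia].
- move=> j; rewrite size_take_min leq_min => /andP[cj /andP[jt jw]].
  by rewrite !adv_take //; apply: cR; rewrite cj.
Qed.

(** * Tines, depths of honest vertices, and settlement by a Catalan slot *)

Section Fork.
Variables (w : seq bool) (F : fork).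
Hypothesis Fw : is_fork w F.
Let r := froot F.
Let n := size w.

Lemma edge_label x y : edge F x y -> flab F x < flab F y.
Proof.
case: Fw => _ H _ _ _ /and3P[yF yr /eqP <-].
by have [] := H _ yF yr.
Qed.

Lemma label_sorted q : path (edge F) r q -> sorted ltn (map (flab F) (r :: q)).
Proof. by move=> pq; rewrite sorted_map; apply: sub_path pq => x y; exact: edge_label. Qed.

Lemma label_inj q x y : path (edge F) r q -> x \in r :: q -> y \in r :: q ->
  flab F x = flab F y -> x = y.
Proof.
move=> pq; have := sorted_uniq ltn_trans ltnn (label_sorted pq).
elim: (r :: q) => //= z p IH /andP[nz up]; rewrite !inE.
case/predU1P=> [->|xp] /predU1P[->|yp] // E; last exact: IH.
- by rewrite E map_f in nz.
- by rewrite -E map_f in nz.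
Qed.

Lemma tine_to v : v \in fV F -> exists2 q, path (edge F) r q & last r q = v.
Proof.
have [m] := ubnP (flab F v); elim: m v => // m IH v vm vF.
have [->|vr] := eqVneq v r; first by exists [::].
have [_ H _ _ _] := Fw; have [pF lp] := H _ vF vr.
have [|q pq lq] := IH _ _ pF; first by lia.
by exists (rcons q v); rewrite ?rcons_path ?last_rcons ?pq // lq /edge vF vr /=.
Qed.

Lemma tine_unique q q' : path (edge F) r q -> path (edge F) r q' ->
  last r q = last r q' -> q = q'.
Proof.
elim/last_ind: q q' => [|q x IH] q'; elim/last_ind: q' => [|q' x' _] //.
- by rewrite rcons_path last_rcons => _ /andP[_ /and3P[_ /eqP nr _]] /= E; rewrite -E in nr.
- by rewrite rcons_path last_rcons => /andP[_ /and3P[_ /eqP nr _]] _ /= E; rewrite E in nr.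
rewrite !rcons_path !last_rcons => /andP[pq e] /andP[pq' e'] E; rewrite -{}E in e' *.
by rewrite (IH q') //; case/and3P: e => _ _ /eqP <-; case/and3P: e' => _ _ /eqP <-.
Qed.

Lemma tine_mem q x : path (edge F) r q -> x \in r :: q -> x \in fV F.
Proof.
move=> pq; rewrite inE => /orP[/eqP ->|]; first by case: Fw => -[].
elim: q (r) pq => //= y q IH z /andP[/and3P[yF _ _] pq].
by rewrite inE => /orP[/eqP ->//|]; exact: IH pq.
Qed.

Definition honest i := (0 < i <= n) && ~~ nth false w i.-1.

Lemma honest_tine i : honest i ->
  exists2 q, path (edge F) r q & flab F (last r q) = i.
Proof.
case/andP=> i1 hi; have [_ _ _ H _] := Fw; have [[v [vF <-]] _] := H i i1 hi.
by have [q pq <-] := tine_to vF; exists q.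
Qed.

(** Extends (F4) to [i = 0]: labels increase strictly, so only the empty path ends at label 0.
    Chains of honest vertices can then start at the root. *)
Lemma honest_deeper i j q q' : (i == 0) || honest i -> honest j -> i < j ->
  path (edge F) r q -> path (edge F) r q' ->
  flab F (last r q) = i -> flab F (last r q') = j -> size q < size q'.
Proof.
move=> hi /andP[/andP[j0 jn] hj] ij pq pq' lq lq'; have [[_ r0] _ _ _ H] := Fw.
have [i0|i0] := eqVneq i 0.
  have -> : q = [::].
    case: q pq lq => //= x q /andP[e pq].
    have := label_sorted (q := x :: q); rewrite /= e pq => /(_ isT) /andP[].
    rewrite path_sortedE; last exact: ltn_trans.
    move=> rx /andP[/allP al _] lq.
    have : flab F x <= flab F (last x q).
      have := mem_last x q; rewrite inE => /orP[/eqP ->//|xq].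
      by apply/ltnW/al/map_f.
    by rewrite lq i0 leqn0 => /eqP x0; rewrite x0 in rx.
  by case: q' lq' {pq'} => //= E; rewrite -E -/r r0 in j0.
move: hi; rewrite (negPf i0) => /andP[/andP[i1 _] hi].
have := H i j i1 ij jn hi hj (r :: q) (r :: q') _ _ lq lq'.
by apply; [exists q|exists q'].
Qed.

(* Depth grows by at least one per honest slot; [m - adv w m] counts the honest
   slots up to [m]. *)
Lemma honest_chain i q m : (i == 0) || honest i ->
  path (edge F) r q -> flab F (last r q) = i -> i <= m <= n ->
  exists e q', [/\ (e == 0) || honest e, e <= m, path (edge F) r q',
     flab F (last r q') = e & size q + m + adv w i <= size q' + i + adv w m].
Proof.
move=> hi pq lq /andP[im]; elim: m im => [|m IH].
  by rewrite leqn0 => /eqP i0 _; exists i, q; split => //; rewrite i0.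
rewrite leq_eqVlt => /orP[/eqP <- _|im mn]; first by exists i, q.
have [|e [q' [he em pq' lq' le]]] := IH im; first exact: ltnW.
rewrite advS; case nm: (nth false w m); last first.
  have hm : honest m.+1 by rewrite /honest /= nm mn.
  have [q2 pq2 lq2] := honest_tine hm.
  have /= lt := honest_deeper he hm em pq' pq2 lq' lq2.
  by exists m.+1, q2; rewrite hm orbT; split => //; lia.
by exists e, q'; split => //; lia.
Qed.

Lemma honest_gap i j q q' : (i == 0) || honest i -> honest j -> i < j ->
  path (edge F) r q -> path (edge F) r q' ->
  flab F (last r q) = i -> flab F (last r q') = j ->
  size q + j + adv w i <= size q' + i + adv w j.
Proof.
move=> hi hj ij pq pq' lq lq'.
have jn : i <= j.-1 <= n by case/andP: hj; lia.
have [e [q2 [he em pq2 lq2 le]]] := honest_chain hi pq lq jn.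
have lt : size q2 < size q' by apply: honest_deeper he hj _ pq2 pq' lq2 lq'; lia.
case: j hj ij lq' jn em le => // j /andP[_ /= hj] _ _ _ _ le.
by rewrite advS (negPf hj); lia.
Qed.

(** Induction along the tine. An adversarial last vertex adds one to both sides. For an honest label
    [l < c], the honest slots between [l] and [c] and the strict record at [c] give the bound. An
    honest [l > c] cannot occur: its depth would be at least depth(c) + 1 + A(l) - A(c), against the
    induction hypothesis. *)
Lemma avoiding_tine_short c qc q : catalan w c ->
  path (edge F) r qc -> flab F (last r qc) = c ->
  path (edge F) r q -> (forall x, x \in q -> flab F x <> c) ->
  size q + adv w c < size qc + adv w (flab F (last r q)).
Proof.
move=> Cc pqc lqc; have hc := catalan_honest Cc; have [c1 cL cR] := Cc.
have {}hc : honest c by rewrite /honest c1.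
have [[_ r0] _ ln _ _] := Fw.
elim/last_ind: q => [_ _|q v IH].
  have := honest_gap (i := 0) (q := [::]) isT hc _ isT pqc r0 lqc.
  by rewrite /= -/r r0 adv0; have := cL 0; rewrite adv0; lia.
rewrite rcons_path last_rcons size_rcons => /andP[pq e] vc.
have {}IH : size q + adv w c < size qc + adv w (flab F (last r q)).
  by apply: IH => // x xq; apply: vc; rewrite mem_rcons inE xq orbT.
have lv := edge_label e; set l := flab F v in lv *.
have vF : v \in fV F by case/and3P: e.
have lc : l <> c by apply: vc; rewrite mem_rcons mem_head.
have lw : l <= n by exact: ln.
have pqv : path (edge F) r (rcons q v) by rewrite rcons_path pq.
have lqv : flab F (last r (rcons q v)) = l by rewrite last_rcons.
have am : adv w (flab F (last r q)) <= adv w l.-1 by apply: adv_homo; lia.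
have ladv : adv w l = adv w l.-1 + nth false w l.-1 by rewrite -advS prednK //; lia.
case nl: (nth false w l.-1) ladv => ladv; first by lia.
have hl : honest l by rewrite /honest nl lw andbT; lia.
have [ltc|] := ltnP l c.
  have hl' : (l == 0) || honest l by rewrite hl orbT.
  have := honest_gap hl' hc ltc pqv pqc lqv lqc; rewrite size_rcons.
  by have := cL _ ltc; lia.
move=> lec; have ltc : c < l by lia.
have hc' : (c == 0) || honest c by rewrite hc orbT.
have := honest_gap hc' hl ltc pqc pqv lqc lqv; rewrite size_rcons.
by have := cR l.-1; lia.
Qed.

(** Honest slots after [c] yield a tine of length at least depth(c) + (n - c) - (A(n) - A(c)). As
    S_n <= S_c, this is at least depth(c) + A(n) - A(c), which exceeds the length of any tine
    avoiding [c]. *)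
Lemma catalan_max_tine c p : catalan w c -> max_tine F p ->
  exists2 x, x \in p & flab F x = c.
Proof.
move=> Cc [[q [-> pq]] mx]; apply: contrapT => nx.
have avoid x : x \in q -> flab F x <> c.
  by move=> xq xc; apply: nx; exists x => //; rewrite inE xq orbT.
have [c1 _ cR] := Cc; have hc : honest c by rewrite /honest c1 (catalan_honest Cc).
have [qc pqc lqc] := honest_tine hc.
have sh := avoiding_tine_short Cc pqc lqc pq avoid.
have hc' : (c == 0) || honest c by rewrite hc orbT.
have cn : c <= n <= n by case/andP: c1 => _ ->; rewrite /=.
have [e [q' [_ _ pq' _ le]]] := honest_chain hc' pqc lqc cn.
have : tine F (r :: q') by exists q'.
move=> /mx; rewrite /tine_len /=.
have := cR n cn; have [_ _ ln _ _] := Fw.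
have /(@adv_homo w) : flab F (last r q) <= n by apply: ln; apply: tine_mem pq (mem_last _ _).
by move: sh le; rewrite /n; lia.
Qed.

(** The path from the root to [x] is unique, and beyond [x] only larger labels occur. *)
Lemma tine_prefix q q' x : path (edge F) r q -> path (edge F) r q' ->
  x \in r :: q -> x \in r :: q' ->
  forall y, y \in r :: q -> flab F y <= flab F x -> y \in r :: q'.
Proof.
move=> pq pq' xq xq' y yq yx.
have split_at q0 : path (edge F) r q0 -> x \in r :: q0 ->
    exists q1 q2, [/\ q0 = q1 ++ q2, path (edge F) r q1, last r q1 = x &
      forall z, z \in q2 -> flab F x < flab F z].
  move=> p0; have := label_sorted p0; move: p0 => + + xq0.
  case/splitPl: xq0 => q1 q2 lx; rewrite cat_path => /andP[p1 p2] so; exists q1, q2; split => //.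
  move=> z zq2; move: so; rewrite map_cons map_cat /= cat_path => /andP[_].
  by rewrite last_map lx path_sortedE // => [/andP[/allP + _]|]; [apply; exact: map_f|exact: ltn_trans].
have [q1 [q2 [E p1 l1 a1]]] := split_at _ pq xq.
have [q1' [q2' [E' p1' l1' a1']]] := split_at _ pq' xq'.
have E1 : q1 = q1' by apply: tine_unique => //; rewrite l1.
move: yq; rewrite E E' -E1 -!cat_cons !mem_cat => /orP[->//|/a1]; lia.
Qed.

Lemma catalan_settled s c : catalan w c -> s <= c -> ~ unsettled s F.
Proof.
move=> Cc sc [p1 [p2 [m1 [m2 [x1 [x1p [x1s H]]]]]]].
have [y1 y1p y1c] := catalan_max_tine Cc m1.
have [y2 y2p y2c] := catalan_max_tine Cc m2.
case: m1 m2 y1p y2p x1p H => -[q1 [-> pq1]] _ [[q2 [-> pq2]] _] y1p y2p x1p.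
have hc := catalan_honest Cc; have [c1 _ _] := Cc.
have [_ _ _ /(_ c c1 hc)[_ uc] _] := Fw.
have E : y1 = y2 by apply: uc => //; [exact: tine_mem pq1 y1p|exact: tine_mem pq2 y2p].
rewrite -{}E {y2c} in y2p.
have x1p2 : x1 \in r :: q2 by apply: tine_prefix pq1 pq2 y1p y2p _ x1p _; rewrite x1s y1c.
case=> [[x2 [x2p [x2s]]]|/(_ _ x1p2) //].
by apply; apply: label_inj pq2 _ _ _ => //; rewrite x1s.
Qed.

End Fork.

(** * The game: winnable strings and an optimal adversary *)

Definition nocat (s k : nat) (w : seq bool) : Prop :=
  forall c, s < c <= s + k -> ~ catalan w c.

Lemma wins_nocat A s k w : wins A s k (size w) w -> nocat s k w.
Proof.
case=> leg [t [/andP[skt tw] uns]] c /andP[sc csk] Cc.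
have t1 : 1 <= t <= size w by lia.
have [_ [Ft _]] := leg t t1.
have Cct : catalan (take t w) c by apply: catalan_take => //; lia.
exact: (@catalan_settled _ _ Ft s c Cct (ltnW sc) uns).
Qed.

Definition winnable (s k : nat) (w : seq bool) : Prop :=
  exists A, wins A s k (size w) w.

Lemma winnable_nocat s k w : winnable s k w -> nocat s k w.
Proof. by case=> A; exact: wins_nocat. Qed.

Lemma is_fork_weaken w w' F : size w = size w' ->
  (forall i, nth false w i -> nth false w' i) -> is_fork w F -> is_fork w' F.
Proof.
move=> sw ww' [F1 F2 F0 F3 F4]; split=> //; rewrite -?sw //.
  by move=> i ir hi; apply: F3 => //; apply: contra hi; exact: ww'.
by move=> i j i1 ij jn hi hj; apply: F4 => //; [apply: contra hi|apply: contra hj]; exact: ww'.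
Qed.

Lemma subfork_trans F G H : subfork F G -> subfork G H -> subfork F H.
Proof.
move=> [V1 r1 l1 p1] [V2 r2 l2 p2]; split.
- by move=> v /V1/V2.
- by rewrite r1.
- by move=> v vF; rewrite l1 // l2 //; exact: V1.
- by move=> v vF vr; rewrite p1 // p2 //; [exact: V1|rewrite -r1].
Qed.

Lemma subfork_extend F v t : subfork F (extend F v t).
Proof.
have fr x : x \in fV F -> x != fresh F.
  by move=> xF; rewrite neq_ltn /fresh ltnS leq_bigmax_seq.
split=> //= x xF; first by rewrite inE xF orbT.
  by rewrite (negPf (fr x xF)).
by rewrite (negPf (fr x xF)).
Qed.

(* On the string with more adversarial slots, the adversary replays the
   recorded game fork by fork, inserting the flipped slot's vertex itself. *)
Lemma winnable_flip s k u v :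
  winnable s k (u ++ false :: v) -> winnable s k (u ++ true :: v).
Proof.
set w := u ++ false :: v; set w' := u ++ true :: v; move=> [A [leg [t [st uns]]]].
have sw : size w = size w' by rewrite !size_cat.
have ww' i : nth false w i -> nth false w' i.
  by rewrite !nth_cat; case: ifP => // _; case: (i - size u).
pose A' := Adversary (fun _ => tieb A w) (fun _ t _ => play A w t) (fun _ t _ => play A w t).
have playE i : play A' w' i = play A w i by case: i.
exists A'; split; last by exists t; rewrite playE -sw.
move=> i; rewrite -sw => it; rewrite !playE; have [H1 [H2 H3]] := leg i it.
have sub : subfork (play A w i.-1) (Fstep A w i (play A w i.-1)).
  by move: H1; rewrite /Fstep; case: (nth _ _ _) => [[]//|_]; exact: subfork_extend.
have fk : is_fork (take i w') (play A w i).
  apply: is_fork_weaken H2; first by rewrite !size_take_min sw.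
  by move=> j; case: (ltnP j i) => ji; [rewrite !nth_take //; exact: ww'|
     rewrite !nth_default // size_take_min geq_min ji].
have sub' : subfork (play A w i) (play A w i) by split.
rewrite /Fstep /=; case wi': (nth false w' i.-1).
  by split; split=> //; exact: subfork_trans sub H3.
have wi : nth false w i.-1 = false by apply: contraFF wi'; exact: ww'.
by move: H1 H3; rewrite /Fstep wi.
Qed.

(** The adversary sees [w] before the first move, so it can pick a best strategy for each string
    separately. *)
Lemma optimal_adversary s k : exists A, forall w, winnable s k w -> wins A s k (size w) w.
Proof.
have /choice [B HB] : forall w, exists B, winnable s k w -> wins B s k (size w) w.
  move=> w; case: (pselect (winnable s k w)) => [[B HB]|nw]; first by exists B.
  by exists (Adversary (fun _ _ _ => 0) (fun _ _ F => F) (fun _ _ F => F)).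
pose A := Adversary (fun w => tieb (B w) w) (fun w => advf (B w) w) (fun w => augf (B w) w).
exists A => w /HB; have playE i : play A w i = play (B w) w i by elim: i => //= i ->.
case=> leg [t [st uns]]; split; last by exists t; rewrite playE.
by move=> i it; rewrite !playE; exact: leg.
Qed.

(** * Catalan slots under flips, shifts and unions of windows *)

Lemma adv_flip u v i : adv (u ++ true :: v) i = adv (u ++ false :: v) i + (size u < i).
Proof.
elim: i => [|i IH]; first by rewrite !adv0.
rewrite !advS IH !nth_cat ltnS; case: (ltngtP i (size u)) => iu; first by lia.
  by case: (i - size u) (subn_gt0 (size u) i) => [|m _] /=; lia.
by rewrite iu subnn /=; lia.
Qed.

(** Turning a slot honest lowers the walk from that slot on, which preserves both strict record
    minima and the bound on later values. *)
Lemma nocat_flip s k u v : nocat s k (u ++ false :: v) -> nocat s k (u ++ true :: v).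
Proof.
move=> nc c sck [c1 cL cR]; apply: (nc c sck); split.
- by move: c1; rewrite !size_cat.
- by move=> i ic; have := cL i ic; rewrite !adv_flip; lia.
- move=> j cj; have := cR j; rewrite !adv_flip !size_cat /= in cj *.
  by move=> /(_ cj); lia.
Qed.

Lemma adv_cat u v i : adv (u ++ v) (size u + i) = count id u + adv v i.
Proof. by rewrite /adv take_cat ltnNge leq_addr addKn count_cat. Qed.

Lemma catalan_drop u v c : 0 < c -> catalan (u ++ v) (size u + c) -> catalan v c.
Proof.
move=> c0 [c1 cL cR]; rewrite size_cat in c1 cR; split.
- by lia.
- by move=> i ic; have := cL (size u + i); rewrite !adv_cat; lia.
- by move=> j cj; have := cR (size u + j); rewrite !adv_cat; lia.
Qed.

(** Cutting off a prefix and a suffix only removes constraints, so a Catalan slot of the whole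
    string is Catalan in [v]. *)
Lemma nocat_shift s k u v x : s + k <= size v ->
  nocat s k v -> nocat (size u + s) k (u ++ v ++ x).
Proof.
move=> skv nc c ck Cc; apply: (nc (c - size u)); first by lia.
have /catalan_take/(_ Cc) : c <= size u + size v by lia.
rewrite takeD take_size_cat // drop_size_cat // take_size_cat // => {}Cc.
by apply: catalan_drop (u) _ _ _ _; [lia|rewrite subnKC //; lia].
Qed.

Lemma nocat_add s k l w : nocat s k w -> nocat (s + k) l w -> nocat s (k + l) w.
Proof.
move=> n1 n2 c; case: (leqP c (s + k)) => ck cs; [apply: n1|apply: n2]; lia.
Qed.

(** * Evolution of reach and candidate under one more bit *)

Section Step.
Variables (s k : nat).

(* In terms of the walk: S_i >= S_(size u) - r for all i. *)
Definition reach (u : seq bool) (r : nat) : Prop :=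
  forall i, i <= size u -> 2 * adv u (size u) + i <= 2 * adv u i + size u + r.

(* [cand u d]: some slot of the window is Catalan so far and the walk is now
   at least [d] below it. *)
Definition cand (u : seq bool) (d : nat) : Prop :=
  exists c, [/\ s < c <= s + k, catalan u c &
    2 * adv u (size u) + c + d <= 2 * adv u c + size u].

Lemma adv_rcons u b i : i <= size u -> adv (rcons u b) i = adv u i.
Proof. by move=> iu; rewrite /adv -cats1 takel_cat. Qed.

Lemma adv_rcons_last u b : adv (rcons u b) (size u).+1 = adv u (size u) + b.
Proof. by rewrite advS adv_rcons // nth_rcons ltnn eqxx. Qed.

Lemma reach_size u : reach u (size u).
Proof.
move=> i iu; suff : adv u (size u) <= adv u i + (size u - i) by lia.
rewrite /adv take_size -{1}(cat_take_drop i u) count_cat leq_add2l.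
by rewrite (leq_trans (count_size _ _)) // size_drop.
Qed.

Lemma reach_true u r : reach u r -> reach (rcons u true) r.+1.
Proof.
move=> H i; rewrite size_rcons adv_rcons_last leq_eqVlt ltnS => /predU1P[->|iu].
  by rewrite adv_rcons_last; lia.
by rewrite adv_rcons //; have := H i iu; lia.
Qed.

(** The truncation of [r.-1] at 0 is intended: the walk is then at a new record minimum, again with
    reach 0. *)
Lemma reach_false u r : reach u r -> reach (rcons u false) r.-1.
Proof.
move=> H i; rewrite size_rcons adv_rcons_last leq_eqVlt ltnS => /predU1P[->|iu].
  by rewrite adv_rcons_last; lia.
by rewrite adv_rcons //; have := H i iu; lia.
Qed.

Lemma catalan_rcons u (b : bool) c : catalan u c ->
  2 * (adv u (size u) + b) + c <= 2 * adv u c + (size u).+1 -> catalan (rcons u b) c.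
Proof.
move=> [c1 cL cR] H; have cu : c <= size u by lia.
split; rewrite ?size_rcons; first by lia.
  by move=> i ic; rewrite !adv_rcons //; [exact: cL|lia].
move=> j /andP[cj]; rewrite leq_eqVlt ltnS (adv_rcons b cu) => /predU1P[->|ju].
  by rewrite adv_rcons_last.
by rewrite adv_rcons //; apply: cR; rewrite cj.
Qed.

Lemma cand_true u d : cand u d.+1 -> cand (rcons u true) d.
Proof.
move=> [c [sck Cc H]]; have cu : c <= size u by case: Cc => /andP[].
by exists c; split => //; [apply: catalan_rcons|rewrite size_rcons adv_rcons_last adv_rcons] => //; lia.
Qed.

Lemma cand_false u d : cand u d -> cand (rcons u false) d.+1.
Proof.
move=> [c [sck Cc H]]; have cu : c <= size u by case: Cc => /andP[].
by exists c; split => //; [apply: catalan_rcons|rewrite size_rcons adv_rcons_last adv_rcons] => //; lia.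
Qed.

Lemma cand_record u : reach u 0 -> s <= size u < s + k -> cand (rcons u false) 0.
Proof.
move=> H su; exists (size u).+1; split; rewrite ?size_rcons //; try lia.
split; rewrite ?size_rcons ?leqnn //.
- by move=> i iu; rewrite adv_rcons_last adv_rcons //; have := H i iu; lia.
- by move=> j ju; have -> : j = (size u).+1 by lia.
Qed.

Lemma cand_not_nocat u d : cand u d -> ~ nocat s k u.
Proof. by move=> [c [sck Cc _]] /(_ c sck). Qed.

End Step.

Local Open Scope ring_scope.

(** * Expectations over bits, Harris' inequality and stochastic domination *)

Section Expectation.
Variable R : realType.
Implicit Types (f g : seq bool -> R) (p : R).

Fixpoint Ex p n f : R :=
  if n is m.+1 then p * Ex p m (f \o cons true) + (1 - p) * Ex p m (f \o cons false)
  else f [::].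

Definition mono f := forall u v, f (u ++ false :: v) <= f (u ++ true :: v).

Lemma mono_cons f b : mono f -> mono (f \o cons b).
Proof. by move=> mf u v; exact: (mf (b :: u) v). Qed.

Lemma sum_tuple_cons n (F : n.+1.-tuple bool -> R) :
  \sum_w F w = \sum_(v : n.-tuple bool) F [tuple of true :: v]
             + \sum_(v : n.-tuple bool) F [tuple of false :: v].
Proof.
rewrite (reindex (fun x : bool * n.-tuple bool => [tuple of x.1 :: x.2])) /=.
  by rewrite -(pair_big predT predT (fun b (v : n.-tuple bool) => F [tuple of b :: v])) big_bool.
exists (fun w => (thead w, [tuple of behead w])) => [[b v] _|w _].
  by congr pair; apply/val_inj.
by rewrite -tuple_eta.
Qed.

Lemma sum_bern (eps : R) n f :
  \sum_(w : n.-tuple bool) bern eps w * f w = Ex ((1 - eps) / 2) n f.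
Proof.
elim: n f => [|n IH] f.
  rewrite (big_pred1 [tuple]) => [|w]; first by rewrite /bern big_ord0 mul1r.
  by apply/esym/eqP; exact: tuple0.
have bernS b (v : n.-tuple bool) : bern eps [tuple of b :: v] =
    (if b then (1 - eps) / 2 else 1 - (1 - eps) / 2) * bern eps v.
  by rewrite /bern big_ord_recl; congr (_ * _); apply: eq_bigr => i _; rewrite tnthS.
rewrite sum_tuple_cons /= -!IH !big_distrr /=.
by congr (_ + _); apply: eq_bigr => v _; rewrite bernS mulrA.
Qed.

Section Bias.
Variable p : R.
Hypotheses (p0 : 0 <= p) (p1 : p <= 1).

Lemma le_Ex n f g : (forall w, size w = n -> f w <= g w) -> Ex p n f <= Ex p n g.
Proof.
elim: n f g => [|n IH] f g fg /=; first exact: fg.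
rewrite lerD // ler_wpM2l ?subr_ge0 //; apply: IH => w sw; apply: fg;
by rewrite /= sw.
Qed.

Lemma Ex_cst n c : Ex p n (fun=> c) = c.
Proof. by elim: n => //= n IH; rewrite !IH -mulrDl subrKC mul1r. Qed.

Lemma Ex_cat m n f : Ex p (m + n) f = Ex p m (fun u => Ex p n (fun v => f (u ++ v))).
Proof. by elim: m f => //= m IH f; rewrite !IH. Qed.

Lemma le_Ex_flip n f : mono f -> Ex p n (f \o cons false) <= Ex p n (f \o cons true).
Proof. by move=> mf; apply: le_Ex => w _; exact: (mf [::] w). Qed.

(** Condition on the first bit. What remains is the covariance of two increasing functions of one
    bit, [p * (1 - p) * ((b - a) * (d - c))]. *)
Lemma harris n f g : mono f -> mono g -> Ex p n f * Ex p n g <= Ex p n (fun w => f w * g w).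
Proof.
elim: n f g => [|n IH] f g mf mg //=.
have le_t := IH _ _ (mono_cons true mf) (mono_cons true mg).
have le_f := IH _ _ (mono_cons false mf) (mono_cons false mg).
have ff := le_Ex_flip n mf; have gg := le_Ex_flip n mg.
apply: (@le_trans _ _ (p * (Ex p n (f \o cons true) * Ex p n (g \o cons true)) +
   (1 - p) * (Ex p n (f \o cons false) * Ex p n (g \o cons false)))); last first.
  by rewrite lerD // ler_wpM2l ?subr_ge0.
rewrite -subr_ge0; set a := Ex _ _ _ in ff *; set b := Ex _ _ _ in ff *.
set c := Ex _ _ _ in gg *; set d := Ex _ _ _ in gg *.
have -> : p * (b * d) + (1 - p) * (a * c) - (p * b + (1 - p) * a) * (p * d + (1 - p) * c) =
  p * (1 - p) * ((b - a) * (d - c)) by ring.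
by rewrite !mulr_ge0 ?subr_ge0.
Qed.

End Bias.

(** [W] need not have total mass 1, so the induction applies to its restriction [Wb b] to first bit
    [b]. The first bit then compares directly: [W] gives bit 1 at most a share [p] of its mass, and
    [f] is larger there. *)
Lemma le_sum_martingale (eps : R) n (W : n.-tuple bool -> R) f :
  0 <= eps <= 1 -> (forall w, 0 <= W w) -> martingale_cond eps W -> mono f ->
  \sum_w W w * f w <= (\sum_w W w) * Ex ((1 - eps) / 2) n f.
Proof.
move=> /andP[e0 e1]; set p : R := (1 - eps) / 2.
elim: n W f => [|n IH] W f W0 mW mf.
  by rewrite mulr_suml; apply: ler_sum => w _; rewrite (tuple0 w).
pose Wb b (v : n.-tuple bool) := W [tuple of b :: v].
have mWb b : martingale_cond eps (Wb b).
  have E (Q : pred (n.+1.-tuple bool)) (Q' : pred (n.-tuple bool)) :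
      (forall c (v : n.-tuple bool), Q [tuple of c :: v] = (c == b) && Q' v) ->
      \sum_(w | Q w) W w = \sum_(v | Q' v) Wb b v.
    move=> QQ; rewrite big_mkcond sum_tuple_cons -!big_mkcond /=.
    rewrite !(eq_bigl _ _ (QQ _)); by case: (b); rewrite /= big_pred0_eq ?addr0 ?add0r.
  move=> t tn x xt; have := mW t.+1 tn (b :: x); rewrite /= xt => /(_ erefl).
  rewrite (E (fun w => (take t.+1 w == b :: x) && nth false w t.+1)
             (fun v => (take t v == x) && nth false v t)) => [|c v].
    by rewrite (E (fun w => take t.+1 w == b :: x) (fun v => take t v == x)).
  by rewrite /= eqseq_cons andbA.
have IHb b : \sum_v Wb b v * (f \o cons b) v <= (\sum_v Wb b v) * Ex p n (f \o cons b).
  by apply: IH; [move=> v; exact: W0|exact: mWb|exact: (mono_cons b mf)].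
have := mW 0 isT [::] erefl.
rewrite [X in _ <= _ * X](eq_bigl predT) => [|w]; last by rewrite take0.
rewrite big_mkcond !sum_tuple_cons /= big1_eq addr0 => le_p.
have le_f := @le_Ex_flip p _ _ n f mf.
apply: le_trans (lerD (IHb true) (IHb false)) _; rewrite -/p in le_p *.
have {}le_f : Ex p n (f \o cons false) <= Ex p n (f \o cons true).
  by apply: le_f; rewrite /p; lra.
set a := \sum_v _ in le_p *; set b := \sum_v _ in le_p *.
rewrite -/a -/b.
set x := Ex p n (f \o cons true) in le_f *; set y := Ex p n (f \o cons false) in le_f *.
rewrite -subr_ge0.
have -> : (a + b) * (p * x + (1 - p) * y) - (a * x + b * y) = (p * (a + b) - a) * (x - y) by ring.
by rewrite mulr_ge0 // subr_ge0.
Qed.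

Definition ind (P : seq bool -> Prop) (w : seq bool) : R := if `[< P w >] then 1 else 0.

Lemma settle_insecE s k T (D : T.-tuple bool -> R) : (forall w, 0 <= D w) ->
  settle_insec s k D = \sum_w D w * ind (winnable s k) w.
Proof.
move=> D0; set P := \sum_w _.
have ub A : win_prob D A s k <= P.
  apply: ler_sum => w _; rewrite ler_wpM2l // /ind; case: asboolP => [wA|_].
    by rewrite asboolT //; exists A; rewrite size_tuple.
  by case: ifP => _; rewrite ?ler01.
have [A HA] := optimal_adversary s k.
apply/eqP; rewrite eq_le; apply/andP; split.
  by apply: ge_sup => [|_ [B ->]//]; exists (win_prob D A s k), A.
apply: (@le_trans _ _ (win_prob D A s k)).
  apply: ler_sum => w _; rewrite ler_wpM2l // /ind; case: asboolP => [/HA wA|_].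
    by rewrite asboolT //; rewrite size_tuple in wA.
  by case: ifP => _; rewrite ?ler01.
by apply: ub_le_sup; [exists P => _ [B ->]|exists A].
Qed.

End Expectation.

Section Bound.
Variable R : realType.

Lemma ind_mono (P : seq bool -> Prop) :
  (forall u v, P (u ++ false :: v) -> P (u ++ true :: v)) -> mono (@ind R P).
Proof.
move=> H u v; rewrite /ind; case: asboolP => [/H Ht|_]; first by rewrite asboolT.
by case: ifP => _; rewrite ?ler01.
Qed.

Lemma ind_le (P Q : seq bool -> Prop) w : (P w -> Q w) -> ind R P w <= ind R Q w.
Proof.
move=> PQ; rewrite /ind; case: asboolP => [/PQ Qw|_]; first by rewrite asboolT.
by case: ifP => _; rewrite ?ler01.
Qed.

(** * Exponential supermartingale for a window without Catalan slots *)

Section Potential.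
Variables (p beta y z th de : R).
Let q := 1 - p.
(** [beta] is the gambler's ruin ratio. [N1] and [N2] are the one-step decay without a candidate, at
    positive and at zero reach; [N3] and [N4] are the same with a candidate, where [t] stands for
    [th * beta ^+ r]. *)
Hypotheses (p0 : 0 <= p) (p1 : p <= 1) (b0 : 0 <= beta) (b1 : beta <= 1)
  (qb : q * beta = p) (y1 : 1 <= y) (z1 : 1 <= z) (th0 : 0 <= th) (de1 : de <= 1)
  (N1 : p * y ^+ 2 + q <= (1 - de) * y)
  (N2 : p * y + p * y * z * (1 + th) <= 1 - de)
  (N3 : forall t, 0 <= t <= th ->
     q + p * t + p * z ^+ 2 + q * z ^+ 2 * t <= (1 - de) * z * (1 + t))
  (N4 : q + th * p + p * y * z ^+ 2 * (1 + th) <= (1 - de) * z * (1 + th)).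
Variables (s k : nat).
Let e u m := Ex p m (fun v => ind R (nocat s k) (u ++ v)).

Let eS u m : e u m.+1 = p * e (rcons u true) m + q * e (rcons u false) m.
Proof.
rewrite /e /=; congr (_ * _ + _ * _); congr Ex;
by apply/funext => v /=; rewrite cat_rcons.
Qed.

Let e_le1 u m : e u m <= 1.
Proof.
rewrite -[leRHS](Ex_cst p m 1); apply: le_Ex => // w _.
by rewrite /ind; case: ifP => _; rewrite ?ler01.
Qed.

Let q0 : 0 <= q. Proof. by rewrite subr_ge0. Qed.

(** Gambler's ruin: losing the candidate takes a rise by [d.+1], and [beta] solves
    [p + q * beta ^+ 2 = beta]. *)
Lemma cand_survival u d m : cand s k u d -> e u m <= beta ^+ d.+1.
Proof.
elim: m u d => [|m IH] u d H.
  rewrite /e /= cats0 /ind asboolF ?exprn_ge0 //; exact: cand_not_nocat H.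
rewrite eS.
have et : e (rcons u true) m <= beta ^+ d.
  by case: d H => [|d] H; [exact: e_le1|exact/IH/cand_true].
have ef := IH _ _ (cand_false H).
apply: le_trans (lerD (ler_wpM2l p0 et) (ler_wpM2l q0 ef)) _.
rewrite -{1}qb !exprS; have -> : q * beta * beta ^+ d + q * (beta * (beta * beta ^+ d)) =
  (q + q * beta) * beta * beta ^+ d by ring.
by rewrite qb /q subrK mul1r.
Qed.

(* Potential of a state with reach [r] whose best candidate lies [a - 1] above the
   walk: [beta ^+ a] is the probability that the candidate is eventually lost,
   and conditioned on that event the walk drifts upwards; [y ^+ (r + a)] accounts
   for the reach at that moment, [z ^+ a] for the time until then, and the last
   factor for the descents of the walk below its current minimum. *)
Let h r a := y ^+ (r + a) * (z * beta) ^+ a * (1 + th * beta ^+ r).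

Let y0 : 0 <= y. Proof. exact: le_trans y1. Qed.
Let z0 : 0 <= z. Proof. exact: le_trans z1. Qed.

Let h_low r a : beta ^+ a <= h r a.
Proof.
have le1 : 1 <= 1 + th * beta ^+ r by rewrite lerDl mulr_ge0 // exprn_ge0.
rewrite /h exprMn -[leLHS]mul1r -[leLHS]mulr1 ler_pM ?mulr_ge0 ?exprn_ge0 //.
by rewrite mulrA ler_wpM2r ?exprn_ge0 // -[leLHS]mulr1 ler_pM // exprn_ege1.
Qed.

Let h0_low r : y ^+ r <= h r 0.
Proof. by rewrite /h addn0 expr0 mulr1 ler_peMr ?exprn_ge0 // lerDl mulr_ge0 // exprn_ge0. Qed.

Let h_step r a : p * h r.+1 a + q * h r.-1 a.+2 <= (1 - de) * h r a.+1.
Proof.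
case: r => [|r] /=.
  have -> : p * h 1 a + q * h 0 a.+2 = y ^+ a.+1 * (z * beta) ^+ a *
      (beta * (q + th * (q * beta) + (q * beta) * y * z ^+ 2 * (1 + th))).
    by rewrite /h !add0n add1n -[in LHS]qb !exprS expr0; ring.
  have -> : (1 - de) * h 0 a.+1 = y ^+ a.+1 * (z * beta) ^+ a *
      (beta * ((1 - de) * z * (1 + th))).
    by rewrite /h add0n !exprS expr0; ring.
  by rewrite qb ler_wpM2l ?mulr_ge0 ?exprn_ge0 // ?mulr_ge0 // ler_wpM2l.
set t := th * beta ^+ r.+1.
have -> : p * h r.+2 a + q * h r a.+2 = y ^+ (r + a.+2) * (z * beta) ^+ a *
    (beta * (q + (q * beta) * t + (q * beta) * z ^+ 2 + q * z ^+ 2 * t)).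
  by rewrite /h /t -[in LHS]qb !addnS !addSn !exprS; ring.
have -> : (1 - de) * h r.+1 a.+1 = y ^+ (r + a.+2) * (z * beta) ^+ a *
    (beta * ((1 - de) * z * (1 + t))).
  by rewrite /h /t !addnS !addSn !exprS; ring.
rewrite qb ler_wpM2l ?mulr_ge0 ?exprn_ge0 // ?mulr_ge0 // ler_wpM2l //.
by apply: N3; rewrite mulr_ge0 ?exprn_ge0 //= ler_piMr // exprn_ile1.
Qed.

(** [j] bits of the window remain and [m] bits follow it. Each window bit gains a factor [1 - de];
    at the end of the window [h] dominates the ruin probability. *)
Lemma window_survival j u r m : (size u + j = s + k)%N -> (s <= size u)%N -> reach u r ->
  e u (j + m) <= (1 - de) ^+ j * y ^+ r /\
  forall d, cand s k u d -> e u (j + m) <= (1 - de) ^+ j * h r d.+1.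
Proof.
have D0 : 0 <= 1 - de by rewrite subr_ge0.
elim: j u r => [|j IH] u r su ssu ru.
  split => [|d H]; rewrite expr0 mul1r; first by rewrite (le_trans (e_le1 _ _)) // exprn_ege1.
  exact: le_trans (cand_survival _ H) (h_low _ _).
have rt := reach_true ru; have rf := reach_false ru.
have sr b : (size (rcons u b) + j = s + k)%N by rewrite size_rcons addSnnS.
have ss b : (s <= size (rcons u b))%N by rewrite size_rcons leqW.
have [t1 t2] := IH _ _ (sr true) (ss true) rt.
have [f1 f2] := IH _ _ (sr false) (ss false) rf.
have comb A B C : e (rcons u true) (j + m) <= (1 - de) ^+ j * A ->
    e (rcons u false) (j + m) <= (1 - de) ^+ j * B ->
    p * A + q * B <= (1 - de) * C -> e u (j.+1 + m) <= (1 - de) ^+ j.+1 * C.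
  move=> eA eB AB; rewrite addSn eS exprSr -mulrA.
  apply: le_trans (lerD (ler_wpM2l p0 eA) (ler_wpM2l q0 eB)) _.
  by rewrite !(mulrCA _ (_ ^+ j)) -mulrDr ler_wpM2l // exprn_ge0.
split => [|d H].
  (* At reach 0 a down step creates a candidate with [d = 0]; this is [N2]. *)
  case: r ru t1 f1 {t2 f2 rt rf} => [|r] ru t1 f1.
    have [_ f2] := IH _ _ (sr false) (ss false) (reach_false ru).
    have H : cand s k (rcons u false) 0.
      by apply: cand_record => //; rewrite ssu -su addnS ltnS leq_addr.
    apply: comb t1 (f2 _ H) _.
    rewrite /h !expr1 expr0 !mulr1 -[X in q * X]mulrA.
    have -> : q * (y ^+ (0.-1 + 1) * (z * beta * (1 + th))) = (q * beta) * y * z * (1 + th).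
      by rewrite expr1; ring.
    by rewrite qb.
  apply: comb t1 f1 _; rewrite /= !exprS.
  have -> : p * (y * (y * y ^+ r)) + q * y ^+ r = y ^+ r * (p * y ^+ 2 + q) by ring.
  by rewrite [leRHS]mulrA [leRHS]mulrC ler_wpM2l // exprn_ge0.
apply: comb (f2 _ (cand_false H)) (h_step _ _).
(* At [d = 0] an up step may destroy the candidate; the bound without candidate takes over, as
   [y ^+ r.+1 <= h r.+1 0]. *)
case: d H => [|d] H; last exact/t2/cand_true.
by apply: le_trans t1 _; rewrite ler_wpM2l // exprn_ge0.
Qed.

(** The [s] bits before the window leave a reach of at most [s], which costs [y ^+ s]. *)
Lemma nocat_decay T : (s + k <= T)%N -> Ex p T (ind R (nocat s k)) <= (1 - de) ^+ k * y ^+ s.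
Proof.
move=> skT; rewrite -(subnKC skT) -addnA Ex_cat -[leRHS](Ex_cst p s); apply: le_Ex => // u su.
have := @reach_size u; rewrite su => ru.
by have [] := @window_survival k u s (T - (s + k))%N _ _ ru; rewrite ?su.
Qed.

End Potential.

(** * Tensor power: joining adjacent windows *)

Section Tensor.
Variables (p : R) (p0 : 0 <= p) (p1 : p <= 1).
Variables (s k T : nat) (skT : (s + k <= T)%N).
Let P := Ex p T (ind R (nocat s k)).

Lemma le_Ex_nocat_shift a b : P <= Ex p (a + (T + b)) (ind R (nocat (a + s) k)).
Proof.
rewrite Ex_cat -[leLHS](Ex_cst p a); apply: le_Ex => // u ua.
rewrite Ex_cat; apply: le_Ex => // v vT; rewrite -[leLHS](Ex_cst p b).
apply: le_Ex => // x _.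
by rewrite /ind; case: asboolP => [/nocat_shift H|_];
  [rewrite asboolT // -ua; apply: H; rewrite vT|case: ifP => _; rewrite ?ler01].
Qed.

(** Padding by [a] and [b] bits puts all windows on one string. Each induction step splits off the
    first window by Harris' inequality and moves its [k] bits into [a]. *)
Lemma nocat_tensor n a b :
  P ^+ n <= Ex p (a + (T + (n * k + b))) (ind R (nocat (a + s) (n * k))).
Proof.
have P0 : 0 <= P.
  by rewrite -[leLHS](Ex_cst p T); apply: le_Ex => // w _; rewrite /ind; case: ifP.
elim: n a => [|n IH] a.
  rewrite expr0 -[leLHS](Ex_cst p (a + (T + (0 * k + b)))); apply: le_Ex => // w _.
  by rewrite /ind asboolT // => c; lia.
have := IH (a + k)%N.
have -> : (a + k + (T + (n * k + b)) = a + (T + (n.+1 * k + b)))%N by lia.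
set N := (a + _)%N => IHn.
apply: (@le_trans _ _ (Ex p N (ind R (nocat (a + s) k)) * Ex p N (ind R (nocat (a + k + s) (n * k))))).
  by rewrite exprS ler_pM ?exprn_ge0 //; exact: le_Ex_nocat_shift.
apply: le_trans (harris p0 p1 _ _ _) _; try (apply: ind_mono; exact: nocat_flip).
apply: le_Ex => // w _; rewrite /ind.
case: asboolP => [n1|_]; last by rewrite mul0r; case: ifP => _; rewrite ?ler01.
case: asboolP => [n2|_]; last by rewrite mulr0; case: ifP => _; rewrite ?ler01.
rewrite asboolT ?mulr1 // mulSn; apply: nocat_add n1 _.
by rewrite addnAC.
Qed.

End Tensor.

(** If [x > y], the powers of [x / y] grow at least linearly by Bernoulli's inequality and exceed
    [A]. *)
Lemma le_of_le_exprM (x y A : R) : 0 <= x -> 0 < y ->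
  (forall n, x ^+ n <= y ^+ n * A) -> x <= y.
Proof.
move=> x0 y0 H; rewrite leNgt; apply/negP => yx.
set t := x / y - 1; have t0 : 0 < t by rewrite subr_gt0 ltr_pdivlMr ?mul1r.
have ht n : 1 + t *+ n <= A.
  have : (1 + t) ^+ n <= A.
    by rewrite /t subrKC expr_div_n ler_pdivrMr ?exprn_gt0 // mulrC.
  apply: le_trans; elim: n => [|n IH]; first by rewrite mulr0n addr0 expr0.
  rewrite exprS mulrSr; apply: le_trans (ler_wpM2l _ IH); last by rewrite addr_ge0 ?ltW.
  have -> : (1 + t) * (1 + t *+ n) = 1 + (t *+ n + t) + t * (t *+ n) by ring.
  by rewrite lerDl mulr_ge0 ?mulrn_wge0 ?ltW.
have A0 : 0 <= A by apply: le_trans (ht 0%N); rewrite addr0.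
have : A / t < (Num.bound (A / t))%:R by rewrite archi_boundP // divr_ge0 // ltW.
rewrite ltr_pdivrMr // mulr_natl ltNge => /negP; apply.
by apply: le_trans (ht (Num.bound (A / t))); rewrite lerDr ler01.
Qed.

End Bound.

(** * Explicit parameters for the potential *)

Section Constants.
Variables (R : realType) (x : R).
(* The first inequality forces de <= x (y - 1), so the choice of y - 1 of order x^2
   makes the rate cubic. *)
Local Notation p := ((1 - x) / 2).
Local Notation y := (1 + x ^+ 2 / 16).
Local Notation z := (1 + x / 8).
Local Notation th := (x / 4).
Local Notation de := (x ^+ 3 / 64).

Let pow_itv : 0 < x < 1 ->
  [/\ 0 < x, x < 1, 0 <= x ^+ 2 <= 1, 0 <= x ^+ 3 <= 1 & 0 <= x ^+ 4 <= 1].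
Proof. by move=> /andP[x0 x1]; split=> //; rewrite exprn_ge0 ?exprn_ile1 ?ltW. Qed.

Lemma constants_reach : 0 < x < 1 -> p * y ^+ 2 + (1 - p) <= (1 - de) * y.
Proof.
move=> /pow_itv[x0 x1 x2_itv x3_itv x4_itv]; rewrite -subr_ge0.
have -> : (1 - de) * y - (p * y ^+ 2 + (1 - p)) = x ^+ 3 * ((48 - 2 * x + x ^+ 2) / 1024).
  by field.
by rewrite mulr_ge0 //; [case/andP: x3_itv|case/andP: x2_itv => *; lra].
Qed.

Lemma constants_record : 0 < x < 1 ->
  p * y + p * y * z * (1 + th) <= 1 - de.
Proof.
move=> /pow_itv[x0 x1 x2_itv x3_itv x4_itv]; rewrite -subr_ge0.
have -> : 1 - de - (p * y + p * y * z * (1 + th)) =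
    x * ((832 + 112 * x + 52 * x ^+ 2 + 11 * x ^+ 3 + x ^+ 4) / 1024).
  by field.
by rewrite mulr_ge0 ?ltW //; case/andP: x2_itv => *; case/andP: x3_itv => *; case/andP: x4_itv => *; lra.
Qed.

(** The difference of the two sides is affine in [t], so the endpoints [0] and [th] suffice. *)
Lemma constants_candidate t : 0 < x < 1 -> 0 <= t <= th ->
  (1 - p) + p * t + p * z ^+ 2 + (1 - p) * z ^+ 2 * t <= (1 - de) * z * (1 + t).
Proof.
move=> /pow_itv[x0 x1 x2_itv x3_itv x4_itv] /andP[t0 tth].
pose f t := (1 - de) * z * (1 + t) - ((1 - p) + p * t + p * z ^+ 2 + (1 - p) * z ^+ 2 * t).
rewrite -subr_ge0 -/(f t).
have f0 : 0 <= f 0.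
  have -> : f 0 = x ^+ 2 * ((60 - 4 * x - x ^+ 2) / 512).
    by rewrite /f; field.
  by rewrite mulr_ge0 //; [case/andP: x2_itv|case/andP: x2_itv => *; lra].
have fth : 0 <= f th.
  have -> : f th = x ^+ 2 * ((240 - 84 * x - 16 * x ^+ 2 - x ^+ 3) / 2048).
    by rewrite /f; field.
  by rewrite mulr_ge0 //; [case/andP: x2_itv|case/andP: x2_itv => *; case/andP: x3_itv => *; lra].
have th0 : 0 < th by rewrite divr_gt0.
rewrite -(pmulr_rge0 _ th0).
have -> : th * f t = f 0 * (th - t) + f th * t by rewrite /f; ring.
by rewrite addr_ge0 // mulr_ge0 // subr_ge0.
Qed.

Lemma constants_descent : 0 < x < 1 ->
  (1 - p) + th * p + p * y * z ^+ 2 * (1 + th) <= (1 - de) * z * (1 + th).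
Proof.
move=> /pow_itv[x0 x1 x2_itv x3_itv x4_itv]; rewrite -subr_ge0.
have -> : (1 - de) * z * (1 + th) - ((1 - p) + th * p + p * y * z ^+ 2 * (1 + th)) =
    x ^+ 2 * ((2752 + 304 * x + 76 * x ^+ 2 + 15 * x ^+ 3 + x ^+ 4) / 8192).
  by field.
by rewrite mulr_ge0 //; [case/andP: x2_itv|case/andP: x2_itv => *; case/andP: x3_itv => *; case/andP: x4_itv => *; lra].
Qed.

End Constants.

(** * The bound without prefactor, and the theorem *)

Section Conclusion.
Variable R : realType.

Lemma nocat_bound (x : R) s k T : 0 < x < 1 -> (s + k <= T)%N ->
  Ex ((1 - x) / 2) T (ind R (nocat s k)) <= (1 - x ^+ 3 / 64) ^+ k.
Proof.
move=> /andP[x0 x1] skT.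
have x3 : 0 <= x ^+ 3 <= 1 by rewrite exprn_ge0 ?exprn_ile1 ?ltW.
have x2 : 0 <= x ^+ 2 by rewrite exprn_ge0 ?ltW.
set p := (1 - x) / 2.
have p0 : 0 <= p by rewrite divr_ge0 // subr_ge0 ltW.
have p1 : p <= 1 by rewrite ler_pdivrMr // mul1r; lra.
(* The prefactor comes from the initial reach and is the same for all [n]. *)
apply: (@le_of_le_exprM _ _ _ ((1 + x ^+ 2 / 16) ^+ s)).
- by rewrite -[leLHS](Ex_cst p T); apply: le_Ex => // w _; rewrite /ind; case: ifP.
- by rewrite exprn_gt0 // subr_gt0 ltr_pdivrMr // mul1r; lra.
move=> n; have := nocat_tensor p0 p1 skT n 0 0; rewrite !add0n addn0 => /le_trans; apply.
rewrite -exprM mulnC.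
have xp : 0 < 1 + x by rewrite addr_gt0.
apply: (@nocat_decay _ p ((1 - x) / (1 + x)) (1 + x ^+ 2 / 16) (1 + x / 8) (x / 4)) => //.
- by rewrite divr_ge0 ?subr_ge0 ?ltW.
- by rewrite ler_pdivrMr // mul1r; lra.
- by rewrite /p; field; rewrite gt_eqF.
- by rewrite lerDl divr_ge0.
- by rewrite lerDl divr_ge0 // ltW.
- by rewrite divr_ge0 // ltW.
- by rewrite ler_pdivrMr // mul1r; lra.
- by apply: constants_reach; rewrite x0.
- by apply: constants_record; rewrite x0.
- by move=> t; apply: constants_candidate; rewrite x0.
- by apply: constants_descent; rewrite x0.
- by rewrite leq_add2r (leq_trans (leq_addr k _)).
Qed.

End Conclusion.

Theorem theorem1 (R : realType) :
  exists c C : R, 0 < c /\ 0 < C /\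
    forall eps : R, 0 < eps < 1 ->
    forall (s k T : nat) (W : T.-tuple bool -> R),
      is_distr W -> martingale_cond eps W ->
      settle_insec s k W <= settle_insec s k (@bern R eps T) /\
      settle_insec s k (@bern R eps T) <= expR (- (c * eps ^+ 3 * (1 - C * eps) * k%:R)).
Proof.
(* The rate obtained is [eps ^+ 3 / 64]; multiplying it by [1 - eps <= 1] gives the stated form. *)
exists (1 / 64), 1; split; first by rewrite divr_gt0.
split=> // eps /andP[e0 e1] s k T W [W0 W1] mW.
have p0 : 0 <= (1 - eps) / 2 by rewrite divr_ge0 // subr_ge0 ltW.
have p1 : (1 - eps) / 2 <= 1 by rewrite ler_pdivrMr // mul1r; lra.
have B0 (w : T.-tuple bool) : 0 <= bern eps w.
  by rewrite prodr_ge0 // => i _; case: ifP => _ //; rewrite subr_ge0.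
rewrite !settle_insecE // sum_bern; split.
  have := @le_sum_martingale R eps T W (ind R (winnable s k)).
  rewrite W1 mul1r; apply=> //; first by rewrite !ltW.
  by apply: ind_mono; exact: winnable_flip.
have e3 : 0 <= eps ^+ 3 <= 1 by rewrite exprn_ge0 ?exprn_ile1 ?ltW.
(* If [T < s + k], no admissible time exists and the adversary never wins. *)
case: (leqP (s + k) T) => skT; last first.
  rewrite (_ : Ex _ _ _ = 0) ?expR_ge0 //; apply/eqP; rewrite eq_le; apply/andP; split.
    rewrite -[leRHS](Ex_cst ((1 - eps) / 2) T); apply: le_Ex => // w sw.
    by rewrite /ind asboolF // => -[A [_ [t [tT _]]]]; lia.
  rewrite -[leLHS](Ex_cst ((1 - eps) / 2) T); apply: le_Ex => // w _.
  by rewrite /ind; case: ifP.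
apply: (@le_trans _ _ ((1 - eps ^+ 3 / 64) ^+ k)).
  apply: le_trans (nocat_bound _ skT); last by rewrite e0.
  by apply: le_Ex => // w _; apply: ind_le; exact: winnable_nocat.
apply: (@le_trans _ _ (expR (- (eps ^+ 3 / 64)) ^+ k)).
  apply: lerXn2r; rewrite ?nnegrE ?expR_ge0 //; last exact: expR_ge1Dx.
  by rewrite subr_ge0 ler_pdivrMr // mul1r; lra.
rewrite -expRM_natr ler_expR -[leRHS]mulNr ler_wpM2r //.
rewrite lerN2 (_ : _ * _ = eps ^+ 3 / 64 * (1 - eps)); last by field.
by rewrite ler_piMr ?divr_ge0 //; lra.
Qed.
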